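(* Let $\mathcal{Y}\subset\mathcal{M}_{k,n}$ be Stiefel coordinates for a subvariety $Y\subset \mathrm{Gr}(k,n)$, let $\alpha\in\binom{[n]}{k}$ be a bracket, and let $F$ be a flag in $\mathbb{C}^n$ represented by an invertible $n\times n$ matrix, also denoted $F$. Let $P(\mathcal{Y})=(p_\beta(\mathcal{Y})\mid\beta\in\binom{[n]}{k})$ be the Pl\''ucker vector of $\mathcal{Y}$ and let $$P(\alpha)(F^{-1})=\bigl(p_{\beta,\gamma}(F^{-1})\ \big|\ \beta\not\le\alpha,\ \gamma\in\tbinom{[n]}{k}\bigr),$$ a rectangular matrix with rows indexed by the brackets $\beta\not\le\alpha$ and columns indexed by all brackets $\gamma$. Then the entries of the matrix-vector product $P(\alpha)(F^{-1})\cdot P(\mathcal{Y})$ cut out $\phi(\mathcal{Y})\cap X_\alpha F$ from $\phi(\mathcal{Y})$; that is, for $H\in\mathcal{Y}$, one has $\phi(H)\in X_\alpha F$ if and only if all entries of $P(\alpha)(F^{-1})\cdot P(H)$ vanish.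
   Context: Fix positive integers $k<n$. $\mathrm{Gr}(k,n)$ is the Grassmannian of $k$-planes in $\mathbb{C}^n$. $\binom{[n]}{k}$ is the set of brackets, i.e. $k$-element subsets $\alpha:\alpha_1<\dots<\alpha_k$ of $[n]=\{1,\dots,n\}$, partially ordered by $\alpha\le\beta\iff\alpha_i\le\beta_i$ for $i=1,\dots,k$. A flag $F$ is a chain of subspaces $F_1\subset\dots\subset F_n=\mathbb{C}^n$ with $\dim F_i=i$; an invertible matrix represents the flag with $F_i$ the span of its first $i$ columns. The Schubert variety is $X_\alpha F=\{H\in\mathrm{Gr}(k,n): \dim(H\cap F_{\alpha_i})\ge i,\ i=1,\dots,k\}$. $\mathcal{M}_{k,n}$ is the set of complex $n\times k$ matrices of rank $k$, and $\phi:\mathcal{M}_{k,n}\to\mathrm{Gr}(k,n)$ sends a matrix to its column span. A set $\mathcal{Y}\subset\mathcal{M}_{k,n}$ is called Stiefel coordinates for a subvariety $Y\subset\mathrm{Gr}(k,n)$ if there is an invertible $n\times n$ matrix $M$ such that $\phi(M\mathcal{Y})$ is dense in $Y$ and the map $\mathcal{Y}\to Y$, $H\mapsto\phi(MH)$, is birational. For an $n\times k$ matrix $H=(h_{i,j})$ and a bracket $\beta$, $p_\beta(H)=\det(h_{\beta_i,j})_{i,j=1}^k$; $P(H)$ is the vector of all $p_\beta(H)$, and $P(\mathcal{Y})$ is this vector as a function on $\mathcal{Y}$. For an $n\times n$ matrix $G$, $p_{\beta,\gamma}(G)=\det(G_{\beta_i,\gamma_j})_{i,j=1}^k$. *)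

(* Defs.v *)
From HB Require Import structures.
From mathcomp Require Import all_boot all_order all_algebra.
From mathcomp Require Import complex mpoly.
From mathcomp Require Import classical_sets reals.

Set Implicit Arguments.
Unset Strict Implicit.
Unset Printing Implicit Defensive.

Import GRing.Theory.
Local Open Scope ring_scope.
Local Open Scope classical_set_scope.

(* All indices are 0-based: i : 'I_n stands for i + 1 in [n]. *)

Definition bracket (n k : nat) : Type := {A : {set 'I_n} | #|A| == k}.

(* Increasing in i because [enum] lists 'I_n in order; see [br_ltn]. *)
Definition br n k (a : bracket n k) (i : 'I_k) : 'I_n :=
  enum_val (cast_ord (esym (eqP (valP a))) i).

Lemma br_ltn n k (a : bracket n k) (i j : 'I_k) :
  (i < j)%N -> (br a i < br a j)%N.
Proof.
case: a => A HA lt_ij; have sA : sorted ltn (map val (enum A)).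
  rewrite {1}/enum_mem -enumT sorted_map.
  apply: sorted_filter; first by move=> x y z; apply: ltn_trans.
  by rewrite -sorted_map val_enum_ord iota_ltn_sorted.
have szA : size (enum A) = k by rewrite -cardE (eqP HA).
have brE l : val (br (exist _ A HA) l) = nth 0%N (map val (enum A)) l.
  rewrite /br (enum_val_nth (br (exist _ A HA) l)) /=.
  by rewrite (nth_map (br (exist _ A HA) l)) ?szA.
suff: ltn (val (br (exist _ A HA) i)) (val (br (exist _ A HA) j)) by [].
rewrite !brE.
by apply: (sorted_ltn_nth ltn_trans 0%N sA) lt_ij; rewrite inE size_map szA.
Qed.

Definition br_le n k (a b : bracket n k) : bool :=
  [forall i : 'I_k, (br a i <= br b i)%N].

Section Geometry.
Variable K : fieldType.

Definition Gr (k : nat) {n : nat} : set {vspace 'cV[K]_n} := [set L | \dim L = k].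

Definition Mkn {k n : nat} : set 'M[K]_(n, k) := [set H | \rank H = k].

Definition phi n k (H : 'M[K]_(n, k)) : {vspace 'cV[K]_n} :=
  <<[seq col j H | j : 'I_k]>>%VS.

(* [E i] is the member of dimension i + 1 of the chain. *)
Definition is_flag n (E : 'I_n -> {vspace 'cV[K]_n}) : Prop :=
  (forall i, \dim (E i) = i.+1) /\
  (forall i j : 'I_n, (i <= j)%N -> (E i <= E j)%VS).

Definition represents n (F : 'M[K]_n) (E : 'I_n -> {vspace 'cV[K]_n}) : Prop :=
  forall i : 'I_n, E i = <<[seq col j F | j : 'I_n <- enum 'I_n & (j <= i)%N]>>%VS.

Definition Schubert n k (a : bracket n k) (E : 'I_n -> {vspace 'cV[K]_n}) :
    set {vspace 'cV[K]_n} :=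
  [set L | Gr k L /\ forall i : 'I_k, (i.+1 <= \dim (L :&: E (br a i)))%N].

Definition plucker n k (b : bracket n k) (H : 'M[K]_(n, k)) : K :=
  \det (\matrix_(i, j) H (br b i) j).

Definition minor n k (b c : bracket n k) (G : 'M[K]_n) : K :=
  \det (\matrix_(i, j) G (br b i) (br c j)).

Definition plucker_vec n k (H : 'M[K]_(n, k)) : 'cV[K]_#|{: bracket n k}| :=
  \col_c plucker (enum_val c) H.

Definition minors_nle n k (a : bracket n k) (G : 'M[K]_n) :
    'M[K]_(#|[pred b : bracket n k | ~~ br_le b a]|, #|{: bracket n k}|) :=
  \matrix_(r, c) minor (enum_val r) (enum_val c) G.

(* A topology is given by its family [cl] of closed sets; [A] is dense, resp.
   open, in [B] for the topology that [cl] induces on [B]. *)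
Definition dense_in T (cl : set (set T)) (A B : set T) : Prop :=
  A `<=` B /\ forall Z, cl Z -> A `<=` Z -> B `<=` Z.

Definition open_in T (cl : set (set T)) (A B : set T) : Prop :=
  exists2 Z, cl Z & A = B `\` Z.

Definition closed_mx {n k : nat} : set (set 'M[K]_(n, k)) :=
  [set Z | exists S : set {mpoly K[n * k]},
    Z = [set H | forall f, S f -> f.@[mxvec H 0] = 0]].

Definition plucker_poly n k := {mpoly K[#|{: bracket n k}|]}.

Definition plucker_eval n k (f : plucker_poly n k) (H : 'M[K]_(n, k)) : K :=
  f.@[fun c => plucker_vec H c 0].

(* Changing the basis of phi H multiplies the Pluecker vector of H by a nonzero
   scalar, so the vanishing of a homogeneous f at it depends only on phi H. *)
Definition closed_Gr (k : nat) {n : nat} : set (set {vspace 'cV[K]_n}) :=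
  [set Z | exists2 S : set (plucker_poly n k),
    (forall f, S f -> exists d, f \is d.-homog) &
    Z = @phi n k @` [set H | Mkn H /\ forall f, S f -> plucker_eval f H = 0]].

(* Irreducibility is not required. *)
Definition subvariety k n (Y : set {vspace 'cV[K]_n}) : Prop := closed_Gr k Y.

(* Matrix-valued regular maps on V: locally, each entry is a quotient of
   homogeneous polynomials of the same degree in the Pluecker coordinates. *)
Definition regular_on k n (V : set {vspace 'cV[K]_n})
    (psi : {vspace 'cV[K]_n} -> 'M[K]_(n, k)) : Prop :=
  forall L, V L -> exists W : set {vspace 'cV[K]_n},
    [/\ open_in (closed_Gr k) W V, W L &
      forall i j, exists d (f g : plucker_poly n k),
        [/\ f \is d.-homog, g \is d.-homog &
          forall H, Mkn H -> W (phi H) ->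
            plucker_eval g H != 0 /\
            psi (phi H) i j = plucker_eval f H / plucker_eval g H]].

(* The map H |-> phi (M H), which is regular everywhere, restricts to an
   isomorphism from a dense open subset U of Ycal onto a dense open subset V
   of Y. *)
Definition birational_via k n (M : 'M[K]_n) (Ycal : set 'M[K]_(n, k))
    (Y : set {vspace 'cV[K]_n}) : Prop :=
  exists (U : set 'M[K]_(n, k)) (V : set {vspace 'cV[K]_n})
         (psi : {vspace 'cV[K]_n} -> 'M[K]_(n, k)),
    [/\ open_in closed_mx U Ycal /\ dense_in closed_mx U Ycal,
        open_in (closed_Gr k) V Y /\ dense_in (closed_Gr k) V Y,
        regular_on V psi,
        forall H, U H -> V (phi (M *m H)) /\ psi (phi (M *m H)) = H &
        forall L, V L -> U (psi L) /\ phi (M *m psi L) = L].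

Definition Stiefel_coordinates k n (Ycal : set 'M[K]_(n, k))
    (Y : set {vspace 'cV[K]_n}) : Prop :=
  Ycal `<=` Mkn /\
  exists M : 'M[K]_n,
    [/\ M \in unitmx,
        dense_in (closed_Gr k) [set phi (M *m H) | H in Ycal] Y &
        birational_via M Ycal Y].

End Geometry.

(* Main.v *)
Require Import Defs.
From mathcomp Require Import classical_sets reals.
From mathcomp Require Import all_boot all_order all_algebra perm zify.
From mathcomp Require Import complex.

Set Implicit Arguments.
Unset Strict Implicit.
Unset Printing Implicit Defensive.

Import GRing.Theory.

Local Open Scope ring_scope.

(** Put G = F^-1 H, an n x k matrix of rank k. Both sides of the equivalence
    are statements about the rows of G.

    Cauchy-Binet identifies the entry of index b of the matrix-vector product
    with the Pluecker coordinate p_b(G) ([minors_mul_plucker]); it vanishes iff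
    the k rows of G selected by b are dependent ([plucker_neq0]).

    The subspace F_c consists of the v such that F^-1 v vanishes at all
    positions after c, so L = phi(H) meets F_c in the kernel, on L, of the map
    that reads off these positions. By rank-nullity, dim (L :&: F_c) is k minus
    the rank of the set of rows of G after c ([dim_phi_cap_flag]). Hence L is in
    the Schubert variety iff for each i (counted from 0) the rows of G after a_i
    have rank less than k - i.

    It remains to compare two conditions on the matroid of rows of G
    ([plucker_nle_eq0]). Observe that b_i > a_i iff b has at least k - i
    elements after a_i ([br_above]). If the rank condition holds and b is not
    below a, these k - i rows are dependent, so p_b(G) = 0. Conversely, if the
    rank condition fails at i, then some k - i rows after a_i are independent;
    they extend to a basis of the row space made of rows of G
    ([row_basis_extend]), which is a bracket b not below a with p_b(G) != 0. *)

(** * Brackets as subsets *)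

Lemma br_inj n k (b : bracket n k) : injective (br b).
Proof. by move=> i j /enum_val_inj /cast_ord_inj. Qed.

Lemma br_val n k (b : bracket n k) i : br b i \in val b.
Proof. exact: enum_valP. Qed.

Lemma br_surj n k (b : bracket n k) x : x \in val b -> exists i, br b i = x.
Proof.
move=> bx; exists (cast_ord (eqP (valP b)) (enum_rank_in bx x)).
by rewrite /br cast_ordK enum_rankK_in.
Qed.

Lemma imset_br n k (b : bracket n k) : [set br b i | i : 'I_k]%SET = val b.
Proof.
apply/setP=> x; apply/imsetP/idP => [[i _ ->]|/br_surj[i <-]].
  exact: br_val.
by exists i.
Qed.

Lemma br_leq n k (b : bracket n k) (i j : 'I_k) :
  (i <= j)%N -> (br b i <= br b j)%N.
Proof.
by rewrite leq_eqVlt => /predU1P[/val_inj-> //|/(br_ltn b)]; apply: ltnW.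
Qed.

Definition above n (c : 'I_n) : {set 'I_n} := [set x : 'I_n | (c < x)%N]%SET.

Lemma card_ord_geq k m : #|[set j : 'I_k | (m <= j)%N]%SET| = (k - m)%N.
Proof.
rewrite -sum1_card -[RHS]muln1 -sum_nat_const_nat big_geq_mkord.
by apply: eq_bigl => j; rewrite inE.
Qed.

(** As b is increasing, the elements of b after c form a final segment of b;
    whether b_i belongs to it can be told from its length. This turns the
    componentwise order on brackets into a count of elements. *)
Lemma br_above n k (b : bracket n k) (i : 'I_k) (c : 'I_n) :
  (c < br b i)%N = (k <= #|val b :&: above c| + i)%N.
Proof.
have -> : #|val b :&: above c| = #|[set j : 'I_k | (c < br b j)%N]%SET|.
  rewrite -(card_imset _ (@br_inj _ _ b)); congr #|pred_of_set _|.
  apply/setP=> x; rewrite !inE;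
    apply/andP/imsetP => [[/br_surj[j <-] lt_c]|[j]].
    by exists j; rewrite ?inE.
  by rewrite inE => lt_c ->; rewrite br_val.
apply/idP/idP => [lt_c|]; first rewrite addnC -leq_subLR -card_ord_geq.
  apply: subset_leq_card; apply/subsetP => j; rewrite !inE => /(br_leq b).
  exact: leq_trans.
apply: contraTT; rewrite -leqNgt -ltnNge => le_c.
have sub : [set j : 'I_k | (c < br b j)%N]%SET
    \subset [set j : 'I_k | (i < j)%N]%SET.
  apply/subsetP => j; rewrite !inE; apply: contraTT; rewrite -!leqNgt => le_ji.
  exact: leq_trans (br_leq b le_ji) le_c.
have := subset_leq_card sub; rewrite card_ord_geq; have := ltn_ord i; lia.
Qed.

(** * The Cauchy-Binet formula *)

Section CauchyBinet.
Variable R : comPzRingType.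

(** Expansion of the determinant along the rows of A *m B, each of which is the
    combination of the rows of B with coefficients a row of A. *)
Lemma det_mulmx_expand k n (A : 'M[R]_(k, n)) (B : 'M[R]_(n, k)) :
  \det (A *m B) =
  \sum_(f : {ffun 'I_k -> 'I_n}) \prod_i A i (f i) * \det (rowsub f B).
Proof.
rewrite /determinant; under eq_bigr => s _.
  under eq_bigr do rewrite mxE.
  rewrite bigA_distr_bigA big_distrr /=.
  over.
rewrite exchange_big; apply: eq_bigr => f _.
rewrite big_distrr; apply: eq_bigr => s _ /=.
rewrite big_split mulrCA; do 2!congr (_ * _).
by apply: eq_bigr => i _; rewrite mxE.
Qed.

(** The injections with image S are the [br S \o s] for s a permutation, and
    permuting the rows of [rowsub (br S) B] by s only brings out the sign of s:
    the sum is the Leibniz expansion of the minor of A. *)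
Lemma det_rowsub_imset k n (S : bracket n k) (A : 'M[R]_(k, n))
    (B : 'M[R]_(n, k)) :
  \sum_(f : {ffun 'I_k -> 'I_n} | injectiveb f && (f @: 'I_k == val S)%SET)
    \prod_i A i (f i) * \det (rowsub f B)
  = \det (colsub (br S) A) * \det (rowsub (br S) B).
Proof.
pose h (s : 'S_k) : {ffun 'I_k -> 'I_n} := [ffun i => br S (s i)].
have h_inj : injective h.
  move=> s t /ffunP st; apply/permP => i.
  by have := st i; rewrite !ffunE => /br_inj.
have hP (f : {ffun 'I_k -> 'I_n}) :
  (injectiveb f && (f @: 'I_k == val S)%SET)
  = (f \in (h @: [set: 'S_k])%SET).
  apply/andP/imsetP => [[/injectiveP f_inj /eqP fS]|[s _ ->]].
    have /fin_all_exists[s sE] i : exists j, br S j = f i.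
      by apply: br_surj; rewrite -fS imset_f.
    have s_inj : injective s.
      by move=> i j ij; apply: f_inj; rewrite -!sE ij.
    by exists (perm s_inj) => //; apply/ffunP=> i; rewrite !ffunE permE sE.
  split; first by apply/injectiveP => i j; rewrite !ffunE => /br_inj /perm_inj.
  apply/eqP; rewrite -imset_br; apply/setP=> x.
  apply/imsetP/imsetP => -[i _ ->]; last first.
    by exists (s^-1%g i); rewrite ?ffunE ?permKV.
  by exists (s i); rewrite ?ffunE.
rewrite (eq_bigl _ _ hP) big_imset /=; last by move=> s t _ _ /h_inj.
rewrite big_distrl /=; apply: eq_big => [s|s _]; first by rewrite inE.
have -> : rowsub (h s) B = perm_mx s *m rowsub (br S) B.
  by rewrite -row_permE; apply/matrixP => i j; rewrite !mxE ffunE.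
rewrite det_mulmx det_perm mulrA; congr (_ * _); rewrite mulrC; congr (_ * _).
by apply: eq_bigr => i _; rewrite mxE ffunE.
Qed.

(** In [det_mulmx_expand] the maps f that are not injective contribute
    determinants with two equal rows; the others are sorted by their image. *)
Lemma cauchy_binet k n (A : 'M[R]_(k, n)) (B : 'M[R]_(n, k)) :
  \det (A *m B) =
  \sum_(S : bracket n k) \det (colsub (br S) A) * \det (rowsub (br S) B).
Proof.
rewrite det_mulmx_expand (bigID (fun f : {ffun _} => injectiveb f)) /=.
rewrite [X in _ + X]big1 ?addr0; last first.
  move=> f /injectivePn[i1 [i2 i12 f12]].
  by rewrite (determinant_alternate i12) ?mulr0 //= => j; rewrite !mxE f12.
pose F (S : {set 'I_n}) :=
  \sum_(f : {ffun 'I_k -> 'I_n} | injectiveb f && (f @: 'I_k == S)%SET)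
    \prod_i A i (f i) * \det (rowsub f B).
rewrite (partition_big (fun f : {ffun _ -> _} => f @: 'I_k)%SET
  (fun S : {set 'I_n} => #|S| == k)) /=; last first.
  by move=> f /injectiveP f_inj; rewrite card_imset // card_ord.
rewrite (big_sub [pred S : {set 'I_n} | #|S| == k] F).
by apply: eq_bigr => S _; exact: det_rowsub_imset.
Qed.

End CauchyBinet.

(** * The matroid of rows of a matrix *)

Section Rank.
Variable K : fieldType.

Section Rows.
Variables (n m : nat) (A : 'M[K]_(n, m)).

Definition row_span (S : {set 'I_n}) : 'M[K]_m :=
  (\sum_(i in S) <<row i A>>)%MS.

Definition row_rank (S : {set 'I_n}) : nat := \rank (row_span S).

Lemma row_spanP (S : {set 'I_n}) p (B : 'M_(p, m)) :
  reflect (forall i, i \in S -> (row i A <= B)%MS) (row_span S <= B)%MS.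
Proof.
apply: (iffP sumsmx_subP) => sAB i /sAB; by rewrite genmxE.
Qed.

Lemma row_sub_span (S : {set 'I_n}) i : i \in S -> (row i A <= row_span S)%MS.
Proof. by move=> Si; apply: (sumsmx_sup i) => //; rewrite genmxE. Qed.

Lemma row_spanS (S T : {set 'I_n}) :
  S \subset T -> (row_span S <= row_span T)%MS.
Proof.
by move=> /subsetP sST; apply/row_spanP => i /sST; apply: row_sub_span.
Qed.

Lemma row_rank_rowsub p (f : 'I_p -> 'I_n) :
  \rank (rowsub f A) = row_rank [set f i | i : 'I_p]%SET.
Proof.
apply/eqP; rewrite eqn_leq; apply/andP; split; apply: mxrankS.
  by apply/row_subP=> i; rewrite row_rowsub row_sub_span // imset_f.
apply/row_spanP => _ /imsetP[i _ ->].
by rewrite -row_rowsub row_sub.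
Qed.

Lemma row_rank_leqS (S T : {set 'I_n}) :
  S \subset T -> (row_rank S <= row_rank T)%N.
Proof. by move=> sST; apply/mxrankS/row_spanS. Qed.

Lemma row_rankT : row_rank [set: 'I_n]%SET = \rank A.
Proof.
transitivity (\rank (rowsub id A)); last by rewrite mxsub_id.
rewrite row_rank_rowsub; congr row_rank.
by apply/setP=> x; rewrite in_setT; apply/esym/imsetP; exists x.
Qed.

Lemma row_rank_leqU (S T : {set 'I_n}) :
  (row_rank T <= row_rank S + #|T :\: S|)%N.
Proof.
have sT : (row_span T <= row_span S + row_span (T :\: S))%MS.
  apply/row_spanP => i Ti; have [Si|Si] := boolP (i \in S).
    by apply: submx_trans (addsmxSl _ _); apply: row_sub_span.
  by apply: submx_trans (addsmxSr _ _); rewrite row_sub_span // inE Si.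
apply: (leq_trans (mxrankS sT)); apply: (leq_trans (mxrank_adds_leqif _ _)).
rewrite leq_add2l (leq_trans (mxrank_sum_leqif _)) //= -sum1_card.
by rewrite leq_sum // => i _; rewrite genmxE rank_leq_row.
Qed.

Lemma row_rank_card (S : {set 'I_n}) : (row_rank S <= #|S|)%N.
Proof.
have := row_rank_leqU set0 S; rewrite setD0 => /leq_trans; apply.
by rewrite /row_rank /row_span big_set0 mxrank0.
Qed.

(** Basis extension: a maximal independent set of rows between S and T has the
    rank of T, since a row of T outside its span could be added to it. *)
Lemma row_basis_extend (S T : {set 'I_n}) :
  S \subset T -> row_rank S = #|S| ->
  exists B : {set 'I_n}, [/\ S \subset B, B \subset T, row_rank B = #|B|
    & row_rank B = row_rank T].
Proof.
move=> sST rS.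
pose P (B : {set 'I_n}) := (B \subset T) && (row_rank B == #|B|).
have PS : P S by rewrite /P sST rS eqxx.
have [B /maxsetP[/andP[sBT /eqP rB] maxB] sSB] := maxset_exists PS.
exists B; split=> //; apply/eqP; rewrite eqn_leq row_rank_leqS //=.
apply/mxrankS/row_spanP => t Tt; apply: contraT => NtB.
have sBtB : B \subset t |: B by apply: subsetUr.
have Bt : t \notin B by apply: contra NtB; apply: row_sub_span.
suff PtB : P (t |: B)%SET by rewrite -(maxB _ PtB sBtB) setU11 in Bt.
rewrite /P subUset sub1set Tt sBT /= eqn_leq row_rank_card cardsU1 Bt -rB /=.
suff : (row_span B < row_span (t |: B))%MS by rewrite ltmxErank => /andP[].
rewrite ltmxE row_spanS //=; apply: contra NtB; apply: submx_trans.
by rewrite row_sub_span // setU11.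
Qed.

End Rows.

(** * Vanishing of Pluecker coordinates *)

Lemma plucker_neq0 n k (G : 'M[K]_(n, k)) (b : bracket n k) :
  (plucker b G != 0) = (row_rank G (val b) == k).
Proof.
have -> : plucker b G = \det (rowsub (br b) G).
  by congr (\det _); apply/matrixP => i j; rewrite !mxE.
by rewrite -unitfE -unitmxE -row_free_unit /row_free row_rank_rowsub imset_br.
Qed.

(** The combinatorial core: the rank conditions of the Schubert variety of a,
    read on the rows of G, amount to the vanishing of all coordinates of index
    not below a. *)
Lemma plucker_nle_eq0 n k (G : 'M[K]_(n, k)) (a : bracket n k) :
  \rank G = k ->
  (forall i : 'I_k, row_rank G (above (br a i)) + i < k)%N <->
  (forall b, ~~ br_le b a -> plucker b G = 0).
Proof.
move=> rG; split=> [rk b|p0 i].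
  (* A failure b_l > a_l puts k - l elements of b in a set of rows of rank less
     than k - l, so that b has rank less than k. *)
  move=> /forallPn[l]; rewrite -ltnNge br_above => ltb.
  apply/eqP; apply: contraT; rewrite plucker_neq0 => /eqP rb.
  set S := val b :&: _ in ltb.
  have := row_rank_leqU G S (val b); rewrite rb.
  have := row_rank_leqS G (subsetIr (val b) (above (br a l))).
  rewrite -/S cardsD (setIidPr (subsetIl _ _)) (eqP (valP b)) -/S.
  have := row_rank_card G S.
  have := rk l; lia.
rewrite ltnNge; apply/negP=> rk.
(* S is a basis of the rows after a_i, B a basis of all rows that contains S. *)
have [S [_ sS rS rSE]] : exists B : {set 'I_n}, [/\ set0 \subset B,
    B \subset above (br a i), row_rank G B = #|B|
  & row_rank G B = row_rank G (above (br a i))].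
  apply: row_basis_extend; rewrite ?sub0set //.
  by apply/eqP; rewrite eqn_leq row_rank_card cards0.
have [B [sSB _ rB rBE]] := row_basis_extend (subsetT S) rS.
have cB : #|B| == k by rewrite -rB rBE row_rankT rG.
pose b : bracket n k := exist _ B cB.
have: plucker b G != 0 by rewrite plucker_neq0 rBE row_rankT rG.
rewrite p0 ?eqxx //; apply/forallPn; exists i.
rewrite -ltnNge br_above (leq_trans rk) // leq_add2r -rSE rS subset_leq_card //.
by rewrite subsetI sSB.
Qed.

(** * Intersection of a column span with a flag *)

Lemma mulmx_sum_col n m (A : 'M[K]_(n, m)) (x : 'cV_m) :
  A *m x = \sum_j x j 0 *: col j A.
Proof.
apply/matrixP=> i j; rewrite ord1 mxE summxE; apply: eq_bigr => l _.
by rewrite !mxE mulrC.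
Qed.

Lemma memv_phi n m (A : 'M[K]_(n, m)) (x : 'cV_m) : A *m x \in phi A.
Proof.
rewrite mulmx_sum_col.
by apply: memv_suml => j _; rewrite memvZ // memv_span // codom_f.
Qed.

Lemma phi_mul n p m (A : 'M[K]_(n, p)) (B : 'M[K]_(p, m)) :
  (phi (A *m B) <= phi A)%VS.
Proof.
by apply/span_subvP => _ /imageP[j _ ->]; rewrite colE -mulmxA memv_phi.
Qed.

(** Each inequality comes from a factorization A = V *m C through r columns: the
    columns of A lie in the span of those of V, and A has rank at most r. For
    the upper bound V is a column base of A, for the lower bound a basis of the
    column span. *)
Lemma dim_phi n m (A : 'M[K]_(n, m)) : \dim (phi A) = \rank A.
Proof.
apply/eqP; rewrite eqn_leq; apply/andP; split.
  rewrite -[A in phi A]mulmx_base (leq_trans (dimvS (phi_mul _ _))) //.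
  by rewrite (leq_trans (dim_span _)) // size_map size_enum_ord.
pose e := vbasis (phi A).
pose V := \matrix_(i < n, l < \dim (phi A)) (e`_l) i 0.
pose C := \matrix_(l < \dim (phi A), j < m) coord e l (col j A).
suff AE : A = V *m C by rewrite {1}AE mulmx_max_rank.
apply/matrixP=> i j.
have /coord_vbasis : col j A \in phi A by rewrite memv_span // codom_f.
move/matrixP/(_ i 0); rewrite mxE => ->; rewrite summxE mxE.
by apply: eq_bigr => l _; rewrite !mxE mulrC.
Qed.

Lemma limg_phi n p m (P : 'M[K]_(p, n)) (A : 'M[K]_(n, m)) :
  (linfun (mulmx P) @: phi A)%VS = phi (P *m A).
Proof.
rewrite limg_span -map_comp; congr (span _); apply: eq_map => j /=.
by rewrite lfunE /= !colE mulmxA.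
Qed.

(** The coefficients of linear forms that cut out the member F_c of the flag:
    the coordinates in the basis of columns of F at the positions after c. *)
Definition flag_equations n (F : 'M[K]_n) (c : 'I_n) : 'M[K]_(#|above c|, n) :=
  rowsub (@enum_val _ (mem (above c))) (invmx F).

Lemma flag_lker n (F : 'M[K]_n) (E : 'I_n -> {vspace 'cV[K]_n}) c :
  F \in unitmx -> represents F E ->
  E c = lker (linfun (mulmx (flag_equations F c))).
Proof.
move=> Fu FE; rewrite FE; apply/eqP; rewrite eqEsubv; apply/andP; split.
  apply/span_subvP => v /mapP[j]; rewrite mem_filter => /andP[le_jc _] ->.
  rewrite memv_ker lfunE /= mul_rowsub_mx colE mulmxA mulVmx // mul1mx.
  apply/eqP/matrixP=> i l; rewrite !mxE.
  have := enum_valP i; rewrite inE => lt_c.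
  rewrite (_ : _ == _ = false) //; apply/eqP => ij.
  by move: lt_c; rewrite ij ltnNge le_jc.
apply/subvP => v; rewrite memv_ker lfunE /= mul_rowsub_mx => /eqP v0.
rewrite -(mulKVmx Fu v); set w := invmx F *m v in v0 *.
rewrite mulmx_sum_col.
apply: memv_suml => j _; have [le_jc|lt_cj] := leqP j c.
  rewrite memvZ // memv_span // (map_f (fun j => col j F)) //.
  by rewrite mem_filter le_jc mem_enum.
have jc : j \in above c by rewrite inE.
have /matrixP/(_ (enum_rank_in jc j) 0) := v0.
by rewrite !mxE enum_rankK_in // => ->; rewrite scale0r mem0v.
Qed.

(** Rank-nullity for the map given by [flag_equations F c] on phi H: its image
    is the column span of the rows of F^-1 H after c. *)
Lemma dim_phi_cap_flag n k (F : 'M[K]_n) (E : 'I_n -> {vspace 'cV[K]_n})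
    (H : 'M[K]_(n, k)) c :
  F \in unitmx -> represents F E ->
  (\dim (phi H :&: E c) + row_rank (invmx F *m H) (above c))%N = \rank H.
Proof.
move=> Fu FE; rewrite (flag_lker c Fu FE) -dim_phi.
rewrite -(limg_ker_dim (linfun (mulmx (flag_equations F c))) (phi H)).
congr (_ + _)%N; rewrite limg_phi dim_phi mul_rowsub_mx row_rank_rowsub.
congr row_rank; apply/setP=> x.
apply/idP/imsetP => [cx|[i _ ->]]; last exact: enum_valP.
by exists (enum_rank_in cx x); rewrite ?enum_rankK_in.
Qed.

(** * The matrix-vector product as a Pluecker vector *)

(** Cauchy-Binet for the product with H of the rows of G in [enum_val r], the
    brackets being numbered by [enum_val] as the columns of [minors_nle]. *)
Lemma minors_mul_plucker n k (a : bracket n k) (G : 'M[K]_n)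
    (H : 'M[K]_(n, k)) r :
  (minors_nle a G *m plucker_vec H) r 0 = plucker (enum_val r) (G *m H).
Proof.
rewrite mxE /plucker.
have -> : (\matrix_(i, j) (G *m H) (br (enum_val r) i) j)
          = rowsub (br (enum_val r)) G *m H.
  by rewrite mul_rowsub_mx; apply/matrixP=> i j; rewrite !mxE.
rewrite cauchy_binet (reindex _ (onW_bij _ (@enum_val_bij (bracket n k)))) /=.
apply: eq_bigr => c _; rewrite !mxE /minor /plucker.
by congr (_ * _); congr (\det _); apply/matrixP => i j; rewrite !mxE.
Qed.

Lemma minors_mul_plucker_eq0 n k (a : bracket n k) (G : 'M[K]_n)
    (H : 'M[K]_(n, k)) :
  (forall r, (minors_nle a G *m plucker_vec H) r 0 = 0) <->
  (forall b, ~~ br_le b a -> plucker b (G *m H) = 0).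
Proof.
split=> [p0 b ba|p0 r]; last first.
  by rewrite minors_mul_plucker; apply: p0; apply: (enum_valP r).
have bin : b \in [pred b : bracket n k | ~~ br_le b a] by [].
by have := p0 (enum_rank_in bin b); rewrite minors_mul_plucker enum_rankK_in.
Qed.

End Rank.

Local Open Scope classical_set_scope.

Theorem theorem1p3 (R : realType) (k n : nat) (k_gt0 : (0 < k)%N)
    (lt_kn : (k < n)%N)
    (Ycal : set 'M[R[i]]_(n, k)) (Y : set {vspace 'cV[R[i]]_n})
    (Yvar : subvariety k Y) (YcalY : Stiefel_coordinates Ycal Y)
    (a : bracket n k)
    (E : 'I_n -> {vspace 'cV[R[i]]_n}) (Eflag : is_flag E)
    (F : 'M[R[i]]_n) (Funit : F \in unitmx) (FE : represents F E)
    (H : 'M[R[i]]_(n, k)) (HYcal : Ycal H) :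
  Schubert a E (phi H) <->
  forall r, (minors_nle a (invmx F) *m plucker_vec H) r 0 = 0.
Proof.
have rH : \rank H = k by case: YcalY => /(_ _ HYcal).
have rG : \rank (invmx F *m H) = k
  by rewrite (eqmxMfull H) // row_full_unit unitmx_inv.
rewrite minors_mul_plucker_eq0 -(plucker_nle_eq0 a rG).
have dim_cap i := dim_phi_cap_flag H (br a i) Funit FE; rewrite rH in dim_cap.
split=> [[_ dimE] i|rk].
  by rewrite -[X in (_ < X)%N](dim_cap i) addnC ltn_add2r dimE.
split=> [|i]; first by rewrite /Gr /= dim_phi.
by have := rk i; rewrite -[X in (_ < X)%N](dim_cap i) addnC ltn_add2r.
Qed.
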